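(* Let $\mathcal{A}$ be a unital $C^*$-algebra and let $\omega$ be a faithful state of $\mathcal{A}$. For any invertible $a\in\mathcal{A}$, $$\|a^{-1}-\omega(a^{-1})\|_2\le\|a^{-1}\|^2\,\|a-\omega(a)\|_2 .$$
   Context: $\|\cdot\|$ is the $C^*$-norm of $\mathcal{A}$. For $a\in\mathcal{A}$, $|a|^2=a^*a$ and $\|a\|_2=\omega(|a|^2)^{1/2}=\omega(a^*a)^{1/2}$. A scalar $\lambda$ appearing in an expression such as $a-\lambda$ stands for $\lambda\mathbf{1}_\mathcal{A}$. *)

(* Defs.v *)
From HB Require Import structures.
From mathcomp Require Import all_boot all_order all_algebra.
From mathcomp Require Import complex.
From mathcomp Require Import all_classical all_reals all_analysis.

Set Implicit Arguments.
Unset Strict Implicit.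
Unset Printing Implicit Defensive.

Import Order.TTheory GRing.Theory Num.Theory.
Import numFieldNormedType.Exports.

Local Open Scope ring_scope.
Local Open Scope classical_set_scope.

(* As for every normedModType over R[i], norms take their values in R[i]; there
   x <= y means that y - x is a nonnegative real, so these values are real.
   The UnitAlgebra layer only names the inverse of an element: it restricts
   nothing but the zero algebra, which has no state. *)
HB.mixin Record isNormedAlgebra (R : realType) A & GRing.UnitAlgebra R[i] A := {
  cnorm : A -> R[i] ;
  ler_cnormD : forall a b : A, cnorm (a + b) <= cnorm a + cnorm b ;
  cnormZ : forall (z : R[i]) (a : A), cnorm (z *: a) = `|z| * cnorm a ;
  cnorm0_eq0 : forall a : A, cnorm a = 0 -> a = 0 ;
  ler_cnormM : forall a b : A, cnorm (a * b) <= cnorm a * cnorm b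
}.

#[short(type="normedAlgType")]
HB.structure Definition NormedAlgebra (R : realType) :=
  { A of GRing.UnitAlgebra R[i] A & isNormedAlgebra R A }.

(* HB cannot join normedModType with the ring structures above numDomainType,
   so the normed module underlying an algebra lives on an alias of its carrier. *)
Definition normed_space (R : realType) (A : normedAlgType R) : Type := A.

HB.instance Definition _ (R : realType) (A : normedAlgType R) :=
  GRing.Lmodule.on (normed_space A).
HB.instance Definition _ (R : realType) (A : normedAlgType R) :=
  @Lmodule_isNormed.Build R[i] (normed_space A)
    (@cnorm R A) (@ler_cnormD R A) (@cnormZ R A) (@cnorm0_eq0 R A).

HB.mixin Record isCStarAlgebra (R : realType) A & NormedAlgebra R A := {
  cnorm_complete : forall F : set_system (normed_space A),
    ProperFilter F -> cauchy F -> cvg F ;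
  star : A -> A ;
  starK : involutive star ;
  starD : forall a b : A, star (a + b) = star a + star b ;
  starZ : forall (z : R[i]) (a : A), star (z *: a) = Num.conj z *: star a ;
  starM : forall a b : A, star (a * b) = star b * star a ;
  cnorm_starM : forall a : A, cnorm (star a * a) = cnorm a ^+ 2
}.

#[short(type="cstarAlgType")]
HB.structure Definition CStarAlgebra (R : realType) :=
  { A of NormedAlgebra R A & isCStarAlgebra R A }.

HB.instance Definition _ (R : realType) (A : cstarAlgType R) :=
  Uniform_isComplete.Build (normed_space A) (@cnorm_complete R A).

Section States.
Context {R : realType} {A : cstarAlgType R}.
Implicit Types (w : {scalar A}) (a : A).

Definition functional_norm w : \bar R :=
  ereal_sup [set (complex.Re `|w a|)%:E | a in [set a : A | cnorm a <= 1]].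

Definition is_state w : Prop :=
  (forall a, 0 <= w (star a * a)) /\ functional_norm w = 1%E.

Definition faithful w : Prop := forall a, w (star a * a) = 0 -> a = 0.

Definition norm2 w a : R[i] := sqrtC (w (star a * a)).

End States.

(* Main.v *)
Require Import Defs.
From HB Require Import structures.
From mathcomp Require Import all_boot all_order all_algebra.
From mathcomp Require Import complex.
From mathcomp Require Import ring lra.
From mathcomp Require Import all_classical all_reals all_analysis.

Import Order.TTheory GRing.Theory Num.Theory.
Import numFieldNormedType.Exports.

Local Open Scope ring_scope.

(** Write [b] for the inverse of [a], [N = cnorm b], [m = w a] and work in the GNS
    semi-inner product [<x, y> = w (x^* y)], with [|x|_2] the associated seminorm.
    Since [w 1 = 1], subtracting [w b] from [b] removes its component along [1],
    so [|b - w b|_2 <= |b - z|_2] for every scalar [z] (lemma [variance_eq]). The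
    choice that works is [z = conj m / |a|_2^2], for which [z a] is the orthogonal
    projection of [1] onto the line of [a]. Indeed [b - z = b (1 - z a)],
    and left multiplication by [b] increases the seminorm by a factor at most [N] (lemma [ip_mul_le]), whence
    [|b - z|_2 <= N |1 - z a|_2]. The squared distance from [1] to the line of [a]
    is [1 - |m|^2 / |a|_2^2 = |a - m|_2^2 / |a|_2^2], and [1 = |b a|_2 <= N |a|_2]
    bounds the remaining factor [1 / |a|_2] by [N]. Altogether
    [|b - w b|_2 <= N |a - m|_2 / |a|_2 <= N^2 |a - m|_2].

    The two facts about states used here, [w 1 = 1] (lemma [state1]) and the bound
    [|b c|_2 <= N |c|_2], come from iterating the Cauchy-Schwarz inequality,
    together with the C*-identity and the boundedness of [w]. *)

(** * Reality and size of complex scalars *)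

(** This is how positivity of a form makes it hermitian: [p] and [q] are its
    values on [(x, y)] and [(y, x)], and polarization with [1] and ['i] yields the
    two reality hypotheses. *)
Lemma conj_of_real (C : numClosedFieldType) (p q : C) :
  p + q \is Num.real -> 'i * (p - q) \is Num.real -> q = Num.conj p.
Proof.
move=> /CrealP + /CrealP; rewrite rmorphM rmorphB rmorphD /= conjCi.
move: (Num.conj p) (Num.conj q) => p' q' e1 e2.
have e3 : q' - p' = p - q by apply: (mulfI (neq0Ci C)); rewrite -e2; ring.
apply: (mulfI (x := 2)); rewrite ?pnatr_eq0 //.
have -> : 2 * p' = (p' + q') - (q' - p') by ring.
by rewrite e1 e3; ring.
Qed.

(** If [s < r], the powers of [r / s > 1] are unbounded by Bernoulli's
    inequality, whatever the constant [K] is. *)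
Lemma le_of_expn2_le (F : archiRealFieldType) (K r s : F) : 0 <= s ->
  (forall n, r ^+ (2 ^ n) <= K * s ^+ (2 ^ n)) -> r <= s.
Proof.
move=> s_ge0 H; rewrite leNgt; apply/negP => sr.
have [s0|s_neq0] := eqVneq s 0.
  by move: (H 0); rewrite s0 !expr1 mulr0 leNgt -{1}s0 sr.
have s_gt0 : 0 < s by rewrite lt_def s_neq0.
pose d := r / s - 1.
have d_gt0 : 0 < d by rewrite subr_gt0 ltr_pdivlMr ?mul1r.
have bern n : 1 + d *+ n <= (1 + d) ^+ n.
  elim: n => [|n IH]; first by rewrite mulr0n addr0 expr0.
  rewrite exprS; apply: le_trans (ler_wpM2l _ IH); last by rewrite addr_ge0 ?ltW.
  have : 0 <= n%:R :> F by []; rewrite mulrS -mulr_natl; nra.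
have K_ge n : d *+ n <= K.
  have := H n; rewrite -ler_pdivrMr ?exprn_gt0 // -expr_div_n; apply: le_trans.
  have -> : r / s = 1 + d by rewrite /d addrC subrK.
  apply: le_trans (bern _); apply: ler_wpDl; first exact: ler01.
  by rewrite ler_wpMn2l ?(ltW d_gt0) ?(ltnW (ltn_expl n _)).
have K_ge0 : 0 <= K by have := K_ge 0%N; rewrite mulr0n.
have := archi_boundP (divr_ge0 K_ge0 (ltW d_gt0)).
by rewrite ltr_pdivrMr // mulr_natl ltNge K_ge.
Qed.

Lemma lec_of_expn2_le (R : realType) (K r s : R[i]) : 0 <= K -> 0 <= r -> 0 <= s ->
  (forall n, r ^+ (2 ^ n) <= K * s ^+ (2 ^ n)) -> r <= s.
Proof.
move=> /ger0_real/RRe_real <- /ger0_real/RRe_real <- s_ge0.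
have /RRe_real s_re := ger0_real s_ge0; rewrite -s_re in s_ge0 *.
move: (complex.Re K) (complex.Re r) (complex.Re s) s_ge0 => {s_re}k {}r {}s.
rewrite !lecR => s_ge0 H; apply: (@le_of_expn2_le _ k) => // n.
by have := H n; rewrite -!rmorphXn -rmorphM lecR.
Qed.

(** * The semi-inner product of a positive functional *)

Section SemiInnerProduct.
Context {R : realType} {A : cstarAlgType R}.
Implicit Types (w : {scalar A}) (a b c x y : A) (z : R[i]).

Lemma star1 : star (1 : A) = 1.
Proof. by rewrite -[LHS]mul1r -{1}[1]starK -starM mul1r starK. Qed.

Lemma starN x : star (- x) = - star x.
Proof. by rewrite -scaleN1r starZ rmorphN1 scaleN1r. Qed.

Lemma cnorm_ge0 x : 0 <= cnorm x.
Proof. exact: (normr_ge0 (x : normed_space A)). Qed.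

Lemma cnorm1 : cnorm (1 : A) = 1.
Proof.
have n1 : cnorm (1 : A) != 0.
  by apply/eqP => /cnorm0_eq0/eqP; rewrite oner_eq0.
by apply: (mulfI n1); rewrite mulr1 -expr2 -cnorm_starM star1 mulr1.
Qed.

Lemma cnormX x n : cnorm (x ^+ n) <= cnorm x ^+ n.
Proof.
elim: n => [|n IHn]; first by rewrite !expr0 cnorm1.
rewrite !exprS; apply: le_trans (ler_cnormM _ _) _.
by rewrite ler_wpM2l ?cnorm_ge0.
Qed.

(** The semi-inner product of the GNS construction. *)
Definition ip w x y : R[i] := w (star x * y).

Lemma ipDl w x1 x2 y : ip w (x1 + x2) y = ip w x1 y + ip w x2 y.
Proof. by rewrite /ip starD mulrDl linearD. Qed.
Lemma ipDr w x y1 y2 : ip w x (y1 + y2) = ip w x y1 + ip w x y2.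
Proof. by rewrite /ip mulrDr linearD. Qed.
Lemma ipZl w z x y : ip w (z *: x) y = Num.conj z * ip w x y.
Proof. by rewrite /ip starZ -scalerAl linearZ. Qed.
Lemma ipZr w z x y : ip w x (z *: y) = z * ip w x y.
Proof. by rewrite /ip -scalerAr linearZ. Qed.
Lemma ipNl w x y : ip w (- x) y = - ip w x y.
Proof. by rewrite /ip starN mulNr linearN. Qed.
Lemma ipNr w x y : ip w x (- y) = - ip w x y.
Proof. by rewrite /ip mulrN linearN. Qed.
Lemma ip1l w x : ip w 1 x = w x.
Proof. by rewrite /ip star1 mul1r. Qed.

Definition ipE := (ipDl, ipDr, ipZl, ipZr, ipNl, ipNr).

Lemma ipMl w b x y : ip w (b * x) y = ip w x (star b * y).
Proof. by rewrite /ip starM mulrA. Qed.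

Definition positive w : Prop := forall a, 0 <= w (star a * a).

Section Positive.
Context {w} (w_ge0 : positive w).

Lemma ip_ge0 x : 0 <= ip w x x. Proof. exact: w_ge0. Qed.

Lemma ipC x y : ip w y x = Num.conj (ip w x y).
Proof.
have re z : z * ip w x y + Num.conj z * ip w y x \is Num.real.
  have -> : z * ip w x y + Num.conj z * ip w y x
    = ip w (x + z *: y) (x + z *: y) - ip w x x - z * Num.conj z * ip w y y.
    by rewrite !ipE; ring.
  by rewrite -normCK !rpredB ?rpredM ?rpredX ?normr_real ?ger0_real ?ip_ge0.
have := re 1; rewrite rmorph1 !mul1r => /conj_of_real; apply.
by rewrite mulrBr -mulNr -conjCi.
Qed.

(** [w] may have null vectors, so the case [ip w x x = 0] is treated apart. *)
Lemma cauchy_schwarz x y : `|ip w x y| ^+ 2 <= ip w x x * ip w y y.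
Proof.
have expand z : 0 <= ip w y y - z * Num.conj (ip w x y)
    - Num.conj z * ip w x y + z * Num.conj z * ip w x x.
  apply: le_trans (ip_ge0 (y - z *: x)) _.
  by rewrite le_eqVlt; apply/orP; left; apply/eqP; rewrite !ipE (ipC x y); ring.
have x_ge0 := ip_ge0 x.
have [x0|x_neq0] := eqVneq (ip w x x) 0.
- (* a null vector [x] is orthogonal to every [y]: otherwise [z] can be chosen
     so that the quadratic expression above equals [- (ip w y y + 2)] *)
  rewrite x0 mul0r; have [->|p0] := eqVneq (ip w x y) 0.
    by rewrite normr0 expr0n.
  have := expand ((ip w y y + 1) / Num.conj (ip w x y)).
  rewrite x0 mulr0 addr0 rmorphM fmorphV /= conjCK divfK ?conjC_eq0 //.
  rewrite divfK // (CrealP _) ?rpredD ?rpred1 ?ger0_real ?ip_ge0 //.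
  have -> : ip w y y - (ip w y y + 1) - (ip w y y + 1) = - (ip w y y + 2) by ring.
  by rewrite oppr_ge0 lt_geF // ltr_wpDl ?ip_ge0.
- have x_gt0 : 0 < ip w x x by rewrite lt_def x_neq0.
  (* [z *: x] is now the orthogonal projection of [y] onto [x] *)
  have := expand (ip w x y / ip w x x).
  rewrite rmorphM fmorphV /= (CrealP (ger0_real x_ge0)) => h.
  rewrite -subr_ge0 normCK.
  set p' := Num.conj (ip w x y) in h *.
  have -> : ip w x x * ip w y y - ip w x y * p' =
      ip w x x * (ip w y y - ip w x y / ip w x x * p' - p' / ip w x x * ip w x y
        + ip w x y / ip w x x * (p' / ip w x x) * ip w x x) by field.
  exact: mulr_ge0.
Qed.
End Positive.
End SemiInnerProduct.

(** * States act on the GNS space with the algebra norm *)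

Section States.
Context {R : realType} {A : cstarAlgType R}.
Implicit Types (w : {scalar A}) (a b c x y : A) (z : R[i]).

(** The supremum defining the norm of a functional bounds it on the unit ball,
    hence everywhere by homogeneity. *)
Lemma functional_norm_ler {w} x :
  functional_norm w = 1%E -> `|w x| <= cnorm x.
Proof.
move=> w1; have [->|x_neq0] := eqVneq x 0.
  by rewrite linear0 normr0 cnorm_ge0.
have x_gt0 : 0 < cnorm x.
  by rewrite lt_def cnorm_ge0 andbT; apply: contra_neq x_neq0; apply: cnorm0_eq0.
pose y := (cnorm x)^-1 *: x.
have ny : cnorm y <= 1.
  by rewrite cnormZ ger0_norm ?invr_ge0 ?cnorm_ge0 // mulVf ?gt_eqF.
have : `|w y| <= 1.
  rewrite -(RRe_real (normr_real _)) lecR -lee_fin -w1.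
  by apply: ereal_sup_ubound; exists y.
rewrite /y linearZ /= normrM ger0_norm ?invr_ge0 ?cnorm_ge0 //.
by rewrite mulrC ler_pdivrMr // mul1r.
Qed.

Section Bounded.
Context {w} (w_ge0 : positive w) (w_le : forall x, `|w x| <= cnorm x).

(** Left multiplication by [b] acts on the GNS space with operator norm at most
    [cnorm b]. With [h = b^* b] this reads [phi h <= cnorm h * phi 1] for the
    positive functional [phi x = w (c^* x c)]. Iterating the Cauchy-Schwarz inequality
    [phi (h^k)^2 <= phi 1 * phi (h^(2k))] gives
    [(phi h / phi 1)^(2^n) <= phi (h^(2^n)) / phi 1], which is at most a constant
    times [cnorm h ^ (2^n)], and the constant disappears by taking [2^n]-th roots. *)
Lemma ip_mul_le b c : ip w (b * c) (b * c) <= cnorm b ^+ 2 * ip w c c.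
Proof.
have c_ge0 := ip_ge0 w_ge0 c.
pose h := star b * b.
have star_h n : star (h ^+ n) = h ^+ n.
  elim: n => [|n IHn]; first by rewrite expr0 star1.
  by rewrite exprS starM IHn [star h]starM starK -exprSr exprS.
pose u n := ip w c (h ^+ (2 ^ n) * c).
have u0 : ip w (b * c) (b * c) = u 0%N.
  by rewrite ipMl /u expr1 mulrA.
have uS n : `|u n| ^+ 2 <= ip w c c * u n.+1.
  have := cauchy_schwarz w_ge0 c (h ^+ (2 ^ n) * c); rewrite ipMl star_h mulrA.
  by rewrite -exprD addnn -mul2n -expnS.
rewrite u0; have [c0|c_neq0] := eqVneq (ip w c c) 0.
  have := uS 0%N; rewrite c0 mul0r mulr0 => u0_le.
  have : `|u 0%N| ^+ 2 == 0 by rewrite eq_le u0_le exprn_ge0.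
  by rewrite sqrf_eq0 normr_eq0 => /eqP ->.
have c_gt0 : 0 < ip w c c by rewrite lt_def c_neq0.
rewrite -ler_pdivrMr // -cnorm_starM -/h.
have u0_ge0 : 0 <= u 0%N by rewrite -u0 ip_ge0.
have pow n : (u 0%N / ip w c c) ^+ (2 ^ n) <= `|u n| / ip w c c.
  elim: n => [|n IHn]; first by rewrite expr1 ger0_norm.
  rewrite expnSr exprM; apply: le_trans (_ : (`|u n| / ip w c c) ^+ 2 <= _).
    by rewrite lerXn2r // nnegrE ?exprn_ge0 ?divr_ge0.
  rewrite expr_div_n [ip w c c ^+ 2]expr2 invfM mulrA ler_pM2r ?invr_gt0 // ler_pdivrMr //.
  rewrite [leRHS]mulrC; apply: le_trans (uS n) _.
  have := le_trans (exprn_ge0 2 (normr_ge0 _)) (uS n).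
  by rewrite pmulr_rge0 // => uS_ge0; rewrite ger0_norm.
pose K := cnorm (star c) * cnorm c / ip w c c.
apply: (@lec_of_expn2_le _ K); rewrite ?divr_ge0 ?mulr_ge0 ?cnorm_ge0 //.
move=> n; apply: le_trans (pow n) _.
rewrite /K mulrAC ler_pM2r ?invr_gt0 //.
apply: le_trans (w_le _) _.
rewrite mulrA; apply: le_trans (ler_cnormM _ _) _.
rewrite [leRHS]mulrAC ler_wpM2r ?cnorm_ge0 //.
apply: le_trans (ler_cnormM _ _) _.
by rewrite ler_wpM2l ?cnorm_ge0 ?cnormX.
Qed.

End Bounded.

(** Cauchy-Schwarz against [1] and the previous bound give
    [|w x| <= w 1 * cnorm x], so that the norm of [w] is at most [w 1]. *)
Lemma state1 {w} : is_state w -> w 1 = 1.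
Proof.
move=> [w_ge0 w_norm]; have w_le x := functional_norm_ler x w_norm.
have ip11 := ip1l w 1.
have w1_ge0 : 0 <= w 1 by rewrite -ip11; exact: w_ge0.
apply/eqP; rewrite eq_le; apply/andP; split.
  by have := w_le 1; rewrite ger0_norm // cnorm1.
(* [w 1] is an upper bound of the set whose supremum is the norm 1 of [w] *)
suff: (1 <= (complex.Re (w 1))%:E)%E by rewrite lee_fin -lecR RRe_real ?ger0_real.
rewrite -w_norm; apply: ge_ereal_sup => _ [x x_le <-].
rewrite lee_fin -lecR !RRe_real ?normr_real ?ger0_real //.
rewrite -(@ler_pXn2r _ 2) ?nnegrE //.
rewrite -[w x]ip1l; apply: le_trans (cauchy_schwarz w_ge0 _ _) _.
rewrite ip11 expr2 ler_wpM2l //.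
rewrite -[x]mulr1; apply: le_trans (ip_mul_le w_ge0 w_le _ _) _.
by rewrite ip11 ler_piMl // expr_le1 ?cnorm_ge0.
Qed.

(** Pythagoras: [w a] is the scalar nearest to [a] for [norm2]. *)
Lemma variance_eq w a z : positive w -> w 1 = 1 ->
  ip w (a - z%:A) (a - z%:A) = ip w a a - `|w a| ^+ 2 + `|z - w a| ^+ 2.
Proof.
move=> w_ge0 w1; rewrite !ipE (ipC w_ge0 1 a) !ip1l w1 !normCK rmorphB /=; ring.
Qed.
End States.

(** * The inequality *)

Theorem theorem3p2 (R : realType) (A : cstarAlgType R) (w : {scalar A})
    (w_state : is_state w) (w_faithful : faithful w)
    (a : A) (a_unit : a \is a GRing.unit) :
  norm2 w (a^-1 - (w a^-1)%:A) <= cnorm a^-1 ^+ 2 * norm2 w (a - (w a)%:A).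
Proof.
have [w_ge0 w_norm] := w_state; have w1 := state1 w_state.
have w_le x := functional_norm_ler x w_norm.
set b := a^-1; set N := cnorm b.
have N_ge0 : 0 <= N by exact: cnorm_ge0.
have ipba c : ip w (b * c) (b * c) <= N ^+ 2 * ip w c c.
  exact: ip_mul_le.
set M := ip w a a.
(* [1 = b * a] bounds [a] from below in the GNS space *)
have M_lb : 1 <= N ^+ 2 * M.
  by have := ipba a; rewrite mulVr // ip1l w1.
have M_gt0 : 0 < M.
  rewrite lt_def ip_ge0 // andbT; apply: contraTneq M_lb => ->.
  by rewrite mulr0 ler10.
(* [z *: a] is the orthogonal projection of [1] onto the line spanned by [a] *)
pose z := Num.conj (w a) / M.
have varb : ip w (b - (w b)%:A) (b - (w b)%:A) <= ip w (b - z%:A) (b - z%:A).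
  by rewrite !variance_eq // lerD2l subrr normr0 expr0n /= exprn_ge0.
have bz : b - z%:A = b * (1 - z *: a).
  by rewrite mulrBr mulr1 -scalerAr mulVr.
have proj : ip w (1 - z *: a) (1 - z *: a) = ip w (a - (w a)%:A) (a - (w a)%:A) / M.
  rewrite variance_eq // subrr normr0 expr0n addr0 -/M.
  rewrite !ipE (ipC w_ge0 1 a) !ip1l w1 -/M normCK /z rmorphM fmorphV /= conjCK.
  by rewrite (CrealP (ger0_real (ltW M_gt0))); field; rewrite gt_eqF.
have Y_ge0 := ip_ge0 w_ge0 (a - (w a)%:A).
rewrite /norm2 -[N ^+ 2](sqrCK (exprn_ge0 2 N_ge0)).
rewrite -sqrtCM ?nnegrE ?exprn_ge0 //.
rewrite ler_sqrtC ?nnegrE ?mulr_ge0 ?exprn_ge0 ?ip_ge0 //.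
rewrite -/(ip w _ _) -/(ip w _ _).
apply: le_trans varb _; rewrite bz; apply: le_trans (ipba _) _; rewrite proj.
rewrite mulrA ler_pdivrMr //; set Y := ip w _ _ in Y_ge0 *.
have -> : (N ^+ 2) ^+ 2 * Y * M = N ^+ 2 * Y * (N ^+ 2 * M) by ring.
by rewrite ler_peMr // mulr_ge0 ?exprn_ge0.
Qed.
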